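(* Let $d\ge 1$, let $\mu$ be a probability measure on $\mathbb{R}^d$, and let $Z(x)$, $x\in\mathbb{R}^d$, be a Gaussian process with zero mean and covariance kernel $k(x,x')\in\mathcal{C}^0(\mathbb{R}^d\times\mathbb{R}^d)$ such that $\sup_{x\in\mathbb{R}^d}k(x,x)<\infty$. Let $(x_i)_{i=1,\dots,n}$ be $n$ independent random points sampled from $\mu$, and let $\tau>0$ be a constant independent of $n$. Let $$k(x,x')=\sum_{p\ge 0}\lambda_p\phi_p(x)\phi_p(x')$$ be the Mercer representation of $k$, where $(\phi_p)_{p}$ is an orthonormal basis of $L^2_\mu(\mathbb{R}^d)$ consisting of eigenfunctions of the operator $(T_{\mu,k}f)(x)=\int_{\mathbb{R}^d}k(x,x')f(x')\,d\mu(x')$ and $(\lambda_p)_p$ is the nonnegative sequence of corresponding eigenvalues sorted in decreasing order. Let $$\sigma^2(x)=k(x,x)-k(x)^T(K+n\tau I)^{-1}k(x)$$ be the mean squared error of the Best Linear Unbiased Predictor of $Z(x)$ from observations of $Z$ at $x_1,\dots,x_n$ with observation noise variance $n\tau$. If the kernel $k$ is non-degenerate, then for every $x\in\mathbb{R}^d$, as $n\to\infty$, $$\sigma^2(x)\longrightarrow\sum_{p\ge 0}\frac{\tau\lambda_p}{\tau+\lambda_p}\phi_p(x)^2$$ in probability. If the kernel $k$ is degenerate, the same convergence holds almost surely. (Probability and almost sure refer to the distribution of the random points $(x_i)$.)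
   Context: Gaussian process regression with noisy observations: one observes $Z(x_i)+\varepsilon(x_i)$, $i=1,\dots,n$, where the noises $\varepsilon(x_i)$ are independent (and independent of $Z$), Gaussian with mean zero and variance $n\tau$; the noise variance is thus proportional to the number $n$ of observations. Notation: $k(x)=[k(x,x_i)]_{1\le i\le n}$ is the $n$-vector of covariances between $Z(x)$ and the $Z(x_i)$, $K=[k(x_i,x_j)]_{1\le i,j\le n}$ is the $n\times n$ covariance matrix, and $I$ is the $n\times n$ identity matrix. The Best Linear Unbiased Predictor (BLUP) is the linear predictor $a(x)^T z^n$, with $z^n$ the vector of noisy observations, minimizing the mean squared error $k(x,x)-2a(x)^Tk(x)+a(x)^T(K+n\tau I)a(x)$; it is attained at $a(x)^T=k(x)^T(K+n\tau I)^{-1}$. The space $L^2_\mu(\mathbb{R}^d)$ is the space of functions that are square integrable with respect to $\mu$. The kernel is called non-degenerate if $\lambda_p>0$ for all $p>0$ (infinitely many eigenvalues), and degenerate if only a finite number of the $\lambda_p$ are not zero. *)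

(* Defs.v *)
From HB Require Import structures.
From mathcomp Require Export all_boot all_order all_algebra finmap.
From mathcomp Require Export all_classical all_reals all_analysis.

Set Implicit Arguments.
Unset Strict Implicit.
Unset Printing Implicit Defensive.

Import Order.TTheory GRing.Theory Num.Theory.
Import numFieldNormedType.Exports.

Local Open Scope classical_set_scope.
Local Open Scope ring_scope.

(* Real matrices, in particular R^d = 'rV[R]_d, carry the Borel sigma-algebra
   of their usual (product) topology. *)
HB.instance Definition _ (R : realType) (m n : nat) :=
  @isMeasurable.Build (sigma_display (@open 'M[R]_(m, n))) 'M[R]_(m, n)
    <<s @open 'M[R]_(m, n) >> (@sigma_algebra0 _ setT _) (@sigma_algebraC _ _)
    (@sigma_algebra_bigcup _ setT _).

Section GaussianProcess.
Context (R : realType) (dO : measure_display) (Omega : measurableType dO)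
  (P : probability Omega R).

(* The case s = 0 of [normal_prob m s] is not the Dirac mass at m, so the
   degenerate Gaussian laws are listed separately. *)
Definition gaussian (Y : Omega -> R) : Prop :=
  (exists m : R, {ae P, forall w, Y w = m}) \/
  (exists m s : R, s != 0 /\
     forall A : set R, measurable A -> P (Y @^-1` A) = normal_prob m s A).

Definition centered_gaussian_process (I : Type) (Z : I -> {RV P >-> R})
    (k : I -> I -> R) : Prop :=
  [/\ forall (m : nat) (x : 'I_m -> I) (c : 'I_m -> R),
        gaussian (fun w => \sum_(i < m) c i * Z (x i) w),
      forall x, ('E_P[Z x] = 0)%E &
      forall x y, covariance P (Z x) (Z y) = (k x y)%:E].

End GaussianProcess.

Section Sampling.
Context (R : realType) (dO dT : measure_display) (Omega : measurableType dO)
  (T : measurableType dT) (P : probability Omega R).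

Definition mutually_independent (X : nat -> {RV P >-> T}) : Prop :=
  forall (J : {fset nat}) (A : nat -> set T), (forall i, measurable (A i)) ->
    P (\bigcap_(i in [set` J]) (X i @^-1` A i)) =
    (\prod_(i <- J) P (X i @^-1` A i))%E.

Definition iid_sample (mu : probability T R) (X : nat -> {RV P >-> T}) : Prop :=
  mutually_independent X /\
  forall i (A : set T), measurable A -> distribution P (X i) A = mu A.

Definition cvg_in_probability (Y : nat -> Omega -> R) (l : R) : Prop :=
  forall e : R, 0 < e ->
    (fun n => P [set w | e <= `|Y n w - l|]) @ \oo --> 0%E.

Definition cvg_almost_surely (Y : nat -> Omega -> R) (l : R) : Prop :=
  {ae P, forall w, (fun n => Y n w) @ \oo --> l}.

End Sampling.

(* A basis of L^2_mu is indexed by an initial segment D of nat: D = setT when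
   L^2_mu is infinite-dimensional, D = {0, ..., N - 1} when it has dimension N
   (mu supported by N points).  Values of phi and lam outside D play no role. *)
Section Mercer.
Context (R : realType) (dT : measure_display) (T : measurableType dT)
  (mu : probability T R).

Definition initial_segment (D : set nat) : Prop :=
  forall p q : nat, (p <= q)%N -> D q -> D p.

Definition inner_L2 (f g : T -> R) : R := \int[mu]_(x in setT) (f x * g x).

Definition orthonormal_basis (D : set nat) (phi : nat -> T -> R) : Prop :=
  [/\ forall p, D p -> phi p \in Lfun mu 2%:E,
      forall p q, D p -> D q -> inner_L2 (phi p) (phi q) = (p == q)%:R &
      forall f, f \in Lfun mu 2%:E ->
        (fun N => 'N[mu]_2%:E[EFin \o (fun x => f x -
           \sum_(0 <= p < N | p \in D) inner_L2 f (phi p) * phi p x)%R]%E)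
        @ \oo --> 0%E].

Definition integral_operator (k : T -> T -> R) (f : T -> R) : T -> R :=
  fun x => \int[mu]_(y in setT) (k x y * f y).

(* The eigenvalue equation is an equality in L^2_mu, hence mu-a.e.; the
   expansion of k holds pointwise on the whole space. *)
Definition mercer_representation (k : T -> T -> R) (D : set nat)
    (lam : nat -> R) (phi : nat -> T -> R) : Prop :=
  [/\ initial_segment D /\ orthonormal_basis D phi,
      forall p, D p ->
        {ae mu, forall x, integral_operator k (phi p) x = lam p * phi p x},
      forall p, D p -> 0 <= lam p,
      forall p q, (p <= q)%N -> D q -> lam q <= lam p &
      forall x y,
        (fun N => \sum_(0 <= p < N | p \in D) lam p * phi p x * phi p y)
        @ \oo --> k x y].

End Mercer.

Definition nondegenerate_spectrum (R : realType) (D : set nat) (lam : nat -> R) : Prop :=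
  infinite_set D /\ forall p, D p -> 0 < lam p.

Definition degenerate_spectrum (R : realType) (D : set nat) (lam : nat -> R) : Prop :=
  finite_set [set p | D p /\ lam p != 0].

Section BLUP.
Context (R : realType) (T : Type) (k : T -> T -> R).

Definition cov_vector (n : nat) (pts : 'I_n -> T) (x : T) : 'cV[R]_n :=
  \col_i k x (pts i).

Definition cov_matrix (n : nat) (pts : 'I_n -> T) : 'M[R]_n :=
  \matrix_(i, j) k (pts i) (pts j).

(* Mean squared error of the predictor sum_i a_i (Z(pts i) + eps_i), where the
   noises are independent with variance n * tau. *)
Definition mse (tau : R) (n : nat) (pts : 'I_n -> T) (x : T)
    (a : 'cV[R]_n) : R :=
  k x x - 2 * (a^T *m cov_vector pts x) 0 0
  + (a^T *m (cov_matrix pts + (n%:R * tau)%:M) *m a) 0 0.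

Definition blup_mse (tau : R) (n : nat) (pts : 'I_n -> T) (x : T) : R :=
  k x x - ((cov_vector pts x)^T
           *m invmx (cov_matrix pts + (n%:R * tau)%:M)
           *m cov_vector pts x) 0 0.

Lemma mse_blup (tau : R) (n : nat) (pts : 'I_n -> T) (x : T) :
  cov_matrix pts + (n%:R * tau)%:M \in unitmx ->
  mse tau pts x ((cov_vector pts x)^T
                 *m invmx (cov_matrix pts + (n%:R * tau)%:M))^T =
  blup_mse tau pts x.
Proof.
rewrite /mse /blup_mse; set A := _ + _; set v := cov_vector _ _ => uA.
rewrite trmxK mulmxKV // trmx_mul trmxK.
have -> : (v^T *m ((invmx A)^T *m v)) 0 0 = (v^T *m invmx A *m v) 0 0.
  have <- : (v^T *m invmx A *m v)^T = v^T *m ((invmx A)^T *m v).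
    by rewrite !trmx_mul trmxK.
  by rewrite [LHS]mxE.
by rewrite mulr_natl mulr2n opprD addrA subrK.
Qed.

End BLUP.

(* The series has nonnegative terms bounded by lam p * phi p x ^+ 2, hence it
   converges as soon as the Mercer expansion of k x x does. *)
Definition limit_mse (R : realType) (T : Type) (tau : R) (D : set nat)
    (lam : nat -> R) (phi : nat -> T -> R) (x : T) : R :=
  limn (fun N => \sum_(0 <= p < N | p \in D)
    tau * lam p / (tau + lam p) * phi p x ^+ 2).

(* Main.v *)
From mathcomp Require Import zify ring lra.
From mathcomp Require Import measurable_realfun.
Require Import Defs.
Import Order.TTheory GRing.Theory Num.Theory.
Import numFieldNormedType.Exports.
Local Open Scope classical_set_scope.
Local Open Scope ring_scope.

Set Implicit Arguments.
Unset Strict Implicit.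
Unset Printing Implicit Defensive.

(**
  With [psi_p = sqrt (lam_p) phi_p], the error of the linear predictor with
  weights [a] is [sum_p u_p ^ 2 + n tau |a| ^ 2], where
  [u_p = psi_p x - sum_i a_i psi_p (x_i)], and [sigma ^ 2] is its minimum in [a].
  Let [b_p = tau / (tau + lam_p) psi_p x], [f = sum_(p < N) b_p psi_p] and
  [P_n h = n ^ -1 sum_i h (x_i)].

  Convex duality bounds [sigma ^ 2] from below by
  [sum_(p < N) (2 b_p psi_p x - b_p ^ 2) - tau ^ -1 P_n (f ^ 2)]; the weights
  [a_i = f (x_i) / (n tau)] bound it from above, where the modes [p >= N] cost at
  most [2 R_N x + 2 P_n (R_N (f / tau) ^ 2)] with
  [R_N y = k y y - sum_(p < N) psi_p y ^ 2].  All averaged functions are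
  bounded because [psi_p y ^ 2 <= k y y], so by the strong law of large numbers
  the two bounds converge almost surely to
  [L_N = sum_(p < N) tau / (tau + lam_p) psi_p x ^ 2] and to [L_N] plus an error
  that vanishes as [N -> oo] by dominated convergence.  Hence the convergence is
  almost sure for every spectrum, and in particular holds in probability.
*)

(** * Strong law of large numbers for bounded functions *)

(** This class is closed under the algebraic operations used below and is integrable against every
    probability measure, so one predicate settles all integrability conditions. *)
Definition bounded_measurable (R : realType) d (T : measurableType d)
    (h : T -> R) : Prop :=
  measurable_fun setT h /\ exists M, forall x, `|h x| <= M.

Section BoundedMeasurable.
Context (R : realType) (d : measure_display) (T : measurableType d).
Implicit Types f g h : T -> R.

Lemma bounded_measurable_cst (c : R) :
  bounded_measurable (fun _ : T => c).
Proof. by split; [exact: measurable_cst | exists `|c|]. Qed.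

Lemma bounded_measurableD f g : bounded_measurable f -> bounded_measurable g ->
  bounded_measurable (fun x => f x + g x).
Proof.
move=> [mf [M fM]] [mg [N gN]]; split; first exact: measurable_funD.
by exists (M + N) => x; rewrite (le_trans (ler_normD _ _)) ?lerD.
Qed.

Lemma bounded_measurableM f g : bounded_measurable f -> bounded_measurable g ->
  bounded_measurable (fun x => f x * g x).
Proof.
move=> [mf [M fM]] [mg [N gN]]; split; first exact: measurable_funM.
by exists (M * N) => x; rewrite normrM ler_pM.
Qed.

Lemma bounded_measurableB f g : bounded_measurable f -> bounded_measurable g ->
  bounded_measurable (fun x => f x - g x).
Proof.
move=> [mf [M fM]] [mg [N gN]]; split; first exact: measurable_funB.
by exists (M + N) => x; rewrite (le_trans (ler_normB _ _)) ?lerD.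
Qed.

Lemma bounded_measurableX f n : bounded_measurable f ->
  bounded_measurable (fun x => f x ^+ n).
Proof.
move=> [mf [M fM]]; split; first exact: measurable_funX.
by exists (M ^+ n) => x; rewrite normrX lerXn2r ?nnegrE// (le_trans _ (fM x)).
Qed.

Lemma bounded_measurable_sum I (s : seq I) (f : I -> T -> R) :
  (forall i, bounded_measurable (f i)) ->
  bounded_measurable (fun x => \sum_(i <- s) f i x).
Proof.
move=> bf; elim: s => [|i s ih].
  under [X in bounded_measurable X]eq_fun do rewrite big_nil.
  exact: bounded_measurable_cst.
under [X in bounded_measurable X]eq_fun do rewrite big_cons.
exact: bounded_measurableD.
Qed.

Lemma bounded_measurable_comp d' (T' : measurableType d') h
    (X : T' -> T) : bounded_measurable h -> measurable_fun setT X ->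
  bounded_measurable (fun x => h (X x)).
Proof.
move=> [mh [M hM]] mX; split; first exact: measurableT_comp.
by exists M.
Qed.

Variable P : probability T R.

Lemma bounded_measurable_integrable h :
  bounded_measurable h -> P.-integrable setT (EFin \o h).
Proof.
move=> [mh [M hM]]; apply: measurable_bounded_integrable => //.
  by move: (fin_num_measure P _ (@measurableT _ T)); rewrite ge0_fin_numE.
exists M; split; first exact: num_real.
by move=> y My x _ /=; rewrite (le_trans (hM x))// ltW.
Qed.

Lemma Rintegral_sum I (s : seq I) (f : I -> T -> R) :
  (forall i, bounded_measurable (f i)) ->
  \int[P]_(x in setT) (\sum_(i <- s) f i x) =
  \sum_(i <- s) \int[P]_(x in setT) f i x.
Proof.
move=> bf; elim: s => [|i s ih].
  under eq_Rintegral do rewrite big_nil.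
  by rewrite big_nil Rintegral_cst// mul0r.
under eq_Rintegral do rewrite big_cons.
rewrite big_cons RintegralD ?ih//; apply: bounded_measurable_integrable => //.
exact: bounded_measurable_sum.
Qed.

Lemma EFin_Rintegral h : bounded_measurable h ->
  (\int[P]_(x in setT) h x)%:E = (\int[P]_(x in setT) (h x)%:E)%E.
Proof.
move=> bh; rewrite /Rintegral fineK//.
by apply: integrable_fin_num => //; exact: bounded_measurable_integrable.
Qed.

End BoundedMeasurable.

(** * Averages along perfect squares *)

Lemma sum_inv_squares_le (R : realType) (n : nat) :
  \sum_(0 <= m < n) (m.+1%:R ^+ 2)^-1 <= 2 :> R.
Proof.
case: n => [|n]; first by rewrite big_nil.
(* The bound is sharpened so that induction closes: with [a = n + 1], the inductive step leaves the
   slack [1 / (a (a + 1) ^ 2)]. *)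
suff : \sum_(0 <= m < n.+1) (m.+1%:R ^+ 2)^-1 <= 2 - n.+1%:R^-1 :> R.
  by move/le_trans; apply; rewrite gerBl invr_ge0.
elim: n => [|n ih].
  by rewrite big_nat1 expr1n invr1; lra.
rewrite big_nat_recr//= (le_trans (lerD ih (lexx _)))//.
have a0 : 0 < n.+1%:R :> R by [].
have -> : n.+2%:R = n.+1%:R + 1 :> R by rewrite -[n.+2]addn1 natrD.
move: (n.+1%:R : R) a0 => a a0.
rewrite -subr_ge0 (_ : _ - _ = (a * (a + 1) ^+ 2)^-1); last first.
  by field; apply/andP; split; lra.
by rewrite invr_ge0 mulr_ge0 ?sqr_ge0// ltW.
Qed.

Lemma square_bracket (n : nat) : exists m, (m * m <= n < m.+1 * m.+1)%N.
Proof.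
elim: n => [|n [m /andP[mn nm]]]; first by exists 0%N.
have [h|h] := ltnP n.+1 (m.+1 * m.+1)%N.
  by exists m; rewrite h andbT (leq_trans mn).
exists m.+1; rewrite h/=; nia.
Qed.

(* For [m ^ 2 <= n < (m + 1) ^ 2] the ratio [(n - m ^ 2) / n] is at most
   [2 / m], so boundedness fills the gaps between perfect squares. *)
Lemma average_cvg_of_squares (R : realType) (y : R^nat) (B : R) :
  (forall i, `|y i| <= B) ->
  (fun m => (m.+1 ^ 2)%:R^-1 * \sum_(i < m.+1 ^ 2) y i) @ \oo --> (0 : R) ->
  (fun n => n%:R^-1 * \sum_(i < n) y i) @ \oo --> (0 : R).
Proof.
move=> yB ysq; apply/cvgr0Pnorm_le => e e0.
have e20 : 0 < e / 2 by rewrite divr_gt0.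
have B0 : 0 <= B by rewrite (le_trans _ (yB 0%N)).
have [M1 _ hM1] := (cvgr0Pnorm_le _).1 ysq _ e20.
(* From [M2] on, [4 B <= m e]; with [m ^ 2 <= n] this bounds the at most [2 m] terms beyond [m ^ 2],
   of total size [2 m B], by [n e / 2]. *)
pose M2 := (Num.truncn (4 * B / e)).+1.
have hM2 : 4 * B / e < M2%:R by exact: truncnS_gt.
(* The shift of [M1] is due to the index [m.+1] in the hypothesis, which is used at [m.-1]. *)
pose M := (maxn M1.+1 M2.+1).
exists (M * M)%N => // n /= Mn.
have [m /andP[mn nm]] := square_bracket n.
have Mm : (M <= m)%N by nia.
have m0 : (0 < m)%N by rewrite (leq_trans _ Mm)// /M leq_max.
have n0 : (0 < n)%N by nia.
rewrite -(big_mkord xpredT y) (big_cat_nat _ (n := m * m))//= mulrDr.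
rewrite (le_trans (ler_normD _ _))// [e]splitr lerD//.
  rewrite (@le_trans _ _ (`|(m.-1.+1 ^ 2)%:R^-1 * \sum_(i < m.-1.+1 ^ 2) y i|))//.
    rewrite !normrM (prednK m0) -[(m ^ 2)%N]/(m * m)%N big_mkord.
    apply: ler_wpM2r => //.
    rewrite !ger0_norm ?invr_ge0// lef_pV2 ?posrE ?ltr0n ?muln_gt0 ?m0//.
    by rewrite ler_nat.
  apply: hM1 => /=; move: Mm; rewrite /M; lia.
rewrite normrM ger0_norm ?invr_ge0//.
have hsum : `|\sum_(m * m <= i < n) y i| <= 2 * m%:R * B.
  rewrite (le_trans (ler_norm_sum _ _ _))//.
  rewrite (@le_trans _ _ (\sum_(m * m <= i < n) B))//; first exact: ler_sum.
  rewrite sumr_const_nat -[leLHS]mulr_natl ler_wpM2r// -natrM ler_nat; nia.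
rewrite ler_pdivrMl ?ltr0n//.
rewrite (le_trans hsum)//.
have mn' : m%:R * m%:R <= n%:R :> R by rewrite -natrM ler_nat.
have m0' : 0 < m%:R :> R by rewrite ltr0n.
have hm : 4 * B / e <= m%:R.
  rewrite (le_trans (ltW hM2))// ler_nat; move: Mm; rewrite /M; lia.
rewrite ler_pdivrMr// in hm.
rewrite (@le_trans _ _ (m%:R * m%:R * (e / 2)))//; last by rewrite ler_wpM2r// ltW.
have -> : m%:R * m%:R * (e / 2) = m%:R * (m%:R * e) / 2 by ring.
have : m%:R * (4 * B) <= m%:R * (m%:R * e) by rewrite ler_pM2l.
lra.
Qed.

Section StrongLaw.
Context (R : realType) (dO : measure_display) (Omega : measurableType dO)
  (P : probability Omega R).

(** By monotone convergence the series of the [f n] has integral at most [C]. It is therefore finite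
    almost everywhere, and where it is finite its terms tend to zero. *)
Lemma ae_cvg0_of_summable_mean (f : nat -> Omega -> R) (c : R^nat) (C : R) :
  (forall n, bounded_measurable (f n)) -> (forall n w, 0 <= f n w) ->
  (forall n, \int[P]_(w in setT) f n w <= c n) ->
  (forall n, \sum_(0 <= m < n) c m <= C) ->
  {ae P, forall w, (fun n => f n w) @ \oo --> (0 : R)}.
Proof.
move=> bf f0 fc cC.
have mf n : measurable_fun setT (fun w => (f n w)%:E).
  by apply/measurable_EFinP; case: (bf n).
have f0' n w : setT w -> (0 <= (f n w)%:E)%E by rewrite lee_fin.
pose F w := (\sum_(0 <= n <oo) (f n w)%:E)%E.
have mF : measurable_fun setT F.
  by apply: ge0_emeasurable_sum => // n w _ _; exact: f0'.
have F0 w : (0 <= F w)%E by apply: nneseries_ge0 => n _ _; rewrite lee_fin.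
have intF : (\int[P]_(w in setT) F w <= C%:E)%E.
  rewrite integral_nneseries//.
  apply: lime_le.
    by apply: is_cvg_nneseries => n _ _; apply: integral_ge0 => w _; exact: f0'.
  apply: nearW => n.
  rewrite (@le_trans _ _ (\sum_(0 <= m < n) (c m)%:E)%E)//.
    by apply: lee_sum => m _; rewrite -EFin_Rintegral// lee_fin.
  by rewrite sumEFin lee_fin.
have iF : P.-integrable setT F.
  apply/integrableP; split => //.
  under eq_integral do rewrite gee0_abs//.
  by rewrite (le_lt_trans intF)// ltry.
apply: filterS (integrable_ae measurableT iF) => w /(_ I) Fw.
apply: (@cvg_series_cvg_0 R R^o).
apply: nondecreasing_is_cvgn.
  by apply: nondecreasing_series => n _ _.
exists (fine (F w)) => _ [n _ <-].
rewrite -lee_fin fineK// /series/= -sumEFin.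
by apply: nneseries_lim_ge => m _ _; rewrite lee_fin.
Qed.

(* The variances of the averages along perfect squares are summable. *)
Lemma strong_law_uncorrelated (Y : nat -> Omega -> R) (B : R) :
  (forall i, measurable_fun setT (Y i)) -> (forall i w, `|Y i w| <= B) ->
  (forall i j, i != j -> \int[P]_(w in setT) (Y i w * Y j w) = 0) ->
  {ae P, forall w, (fun n => n%:R^-1 * \sum_(i < n) Y i w) @ \oo --> (0 : R)}.
Proof.
move=> mY YB Y0.
have bY i : bounded_measurable (Y i) by split => //; exists B.
pose S n w := n%:R^-1 * \sum_(i < n) Y i w.
have bS n : bounded_measurable (S n).
  apply: bounded_measurableM; first exact: bounded_measurable_cst.
  exact: (bounded_measurable_sum _ (fun i => bY _)).
have varS n : \int[P]_(w in setT) (S n w ^+ 2) <= n%:R^-1 * B ^+ 2.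
  (* Once the square is expanded, the off-diagonal terms vanish by [Y0]. *)
  have -> : \int[P]_(w in setT) (S n w ^+ 2) =
     n%:R^-1 ^+ 2 * \sum_(i < n) \int[P]_(w in setT) (Y i w * Y i w).
    under eq_Rintegral.
      move=> w _; rewrite /S exprMn expr2 [X in _ * X]expr2 mulr_suml.
      under eq_bigr do rewrite mulr_sumr.
      over.
    rewrite RintegralZl//; last first.
      apply: bounded_measurable_integrable.
      do 2 (apply: bounded_measurable_sum => ?).
      exact: bounded_measurableM.
    rewrite Rintegral_sum; last first.
      move=> ?; apply: bounded_measurable_sum => ?; exact: bounded_measurableM.
    congr (_ * _); apply: eq_bigr => i _.
    rewrite Rintegral_sum; last by move=> ?; exact: bounded_measurableM.
    rewrite (bigD1 i)//= big1 ?addr0// => j ji.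
    by apply: Y0; rewrite eq_sym.
  (* At [n = 0] both sides are zero, because the inverse of [0] is [0]. *)
  have [->|n0] := posnP n; first by rewrite big_ord0 mulr0 invr0 mul0r.
  rewrite expr2 -mulrA ler_wpM2l ?invr_ge0//.
  rewrite ler_pdivrMl ?ltr0n//.
  have -> : n%:R * B ^+ 2 = \sum_(i < n) B ^+ 2.
    by rewrite sumr_const card_ord mulr_natl.
  apply: ler_sum => i _.
  rewrite (@le_trans _ _ (\int[P]_(w in setT) (B ^+ 2)))//.
    apply: le_Rintegral => //.
    - by apply: bounded_measurable_integrable; exact: bounded_measurableM.
    - by apply: bounded_measurable_integrable; exact: bounded_measurable_cst.
    - move=> w _; rewrite -expr2 -real_normK ?num_real// lerXn2r ?nnegrE//.
      by rewrite (le_trans _ (YB i w)).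
  by rewrite Rintegral_cst//; rewrite [X in fine X]probability_setT /= mulr1.
have : {ae P, forall w, (fun m => S (m.+1 ^ 2)%N w ^+ 2) @ \oo --> (0 : R)}.
  apply: (@ae_cvg0_of_summable_mean _
    (fun m => (m.+1%:R ^+ 2)^-1 * B ^+ 2) (2 * B ^+ 2)).
  - by move=> m; exact: bounded_measurableX.
  - by move=> m w; exact: sqr_ge0.
  - by move=> m; rewrite (le_trans (varS _))// natrX.
  - by move=> n; rewrite -mulr_suml ler_wpM2r ?sqr_ge0// sum_inv_squares_le.
apply: filterS => w Sw; apply: (@average_cvg_of_squares _ (Y ^~ w) B) => //.
apply/norm_cvg0P.
rewrite [X in X @ _ --> _](_ : _ = (fun m => Num.sqrt (S (m.+1 ^ 2)%N w ^+ 2))); last first.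
  by apply/funext => m /=; rewrite sqrtr_sqr.
rewrite -[X in _ --> X](@sqrtr0 R).
apply: continuous_cvg => //; exact: sqrt_continuous.
Qed.

End StrongLaw.

(** * Law of large numbers for functions of an i.i.d. sample *)

Section IidSample.
Context (R : realType) (dO dT : measure_display) (Omega : measurableType dO)
  (T : measurableType dT) (P : probability Omega R) (mu : probability T R)
  (X : nat -> {RV P >-> T}).
Hypothesis hX : iid_sample mu X.

Lemma iid_Rintegral i (h : T -> R) : bounded_measurable h ->
  \int[P]_(w in setT) h (X i w) = \int[mu]_(x in setT) h x.
Proof.
move=> bh; congr fine.
have bhX : bounded_measurable (fun w => h (X i w)).
  exact: bounded_measurable_comp.
rewrite -(@integral_distribution _ _ _ _ _ P (X i) (EFin \o h)).
- by apply: eq_measure_integral => A mA _; exact: hX.2.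
- by apply/measurable_EFinP; case: bh.
- exact: bounded_measurable_integrable.
Qed.

(** Independence makes the law of the pair agree with [mu \x mu] on rectangles, hence everywhere;
    Fubini then factors the integral. *)
Lemma iid_Rintegral_mul i j (g h : T -> R) : i != j ->
  bounded_measurable g -> bounded_measurable h ->
  \int[P]_(w in setT) (g (X i w) * h (X j w)) =
  \int[mu]_(x in setT) g x * \int[mu]_(x in setT) h x.
Proof.
move=> ij bg bh.
have mXX : measurable_fun setT (fun w => (X i w, X j w)).
  exact: measurable_fun_pair.
pose XX := mfun_Sub (mem_set mXX) : {RV P >-> (T * T)%type}.
have law A : measurable A -> (mu \x mu)%E A = distribution P XX A.
  apply: product_measure_unique => B C mB mC.
  (* Only the indices [i] and [j] are tested, so the value [C] away from [i] matters at [j]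
     alone. *)
  have := hX.1 [fset i; j]%fset (fun k => if k == i then B else C).
  rewrite /distribution /pushforward.
  have -> : \bigcap_(k in [set` [fset i; j]%fset])
      X k @^-1` (if k == i then B else C) = XX @^-1` (B `*` C).
    apply/seteqP; split => w /=.
      move=> Hw; split; first by have := Hw i; rewrite eqxx; apply; rewrite /= !inE eqxx.
      by have := Hw j; rewrite eq_sym (negPf ij); apply; rewrite /= !inE eqxx orbT.
    move=> [Bw Cw] k; rewrite /= !inE => /orP[]/eqP->; rewrite ?eqxx//.
    by rewrite eq_sym (negPf ij).
  move=> XXE; rewrite [LHS]XXE; last by move=> k; case: ifP.
  rewrite big_fsetU1/= ?inE// big_seq_fset1 eqxx eq_sym (negPf ij).
  by have [_ hmu] := hX; rewrite -(hmu i)// -(hmu j).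
have bgh : bounded_measurable (fun z : T * T => g z.1 * h z.2).
  apply: bounded_measurableM.
  - exact: (bounded_measurable_comp bg).
  - exact: (bounded_measurable_comp bh).
have mgh : measurable_fun setT (fun z : T * T => (g z.1 * h z.2)%:E).
  by apply/measurable_EFinP; case: bgh.
have igh : (mu \x mu)%E.-integrable setT (fun z : T * T => (g z.1 * h z.2)%:E).
  exact: (bounded_measurable_integrable _ bgh).
have -> : \int[P]_(w in setT) (g (X i w) * h (X j w)) =
    fine (\int[mu]_x \int[mu]_y (g x * h y)%:E)%E.
  congr fine.
  rewrite (@integral12_prod_meas1 _ _ _ _ _ mu mu _ igh).
  transitivity (\int[distribution P XX]_z (g z.1 * h z.2)%:E)%E.
    rewrite integral_distribution//.
    apply: (bounded_measurable_integrable _ (h := fun w => g (X i w) * h (X j w))).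
    exact: bounded_measurable_comp (XX : Omega -> T * T) bgh _.
  by apply: eq_measure_integral => A mA _; exact/esym/law.
under eq_integral.
  move=> x _.
  have -> : (\int[mu]_y (g x * h y)%:E)%E = (g x * \int[mu]_(y in setT) h y)%:E.
    rewrite EFinM EFin_Rintegral// -integralZl//.
    exact: bounded_measurable_integrable.
  over.
by rewrite -[RHS]RintegralZr//; exact: bounded_measurable_integrable.
Qed.

(** After centring, the product formula makes the variables [g (X i)] pairwise uncorrelated. *)
Lemma strong_law (h : T -> R) : bounded_measurable h ->
  {ae P, forall w, (fun n => n%:R^-1 * \sum_(i < n) h (X i w)) @ \oo -->
    (\int[mu]_(x in setT) h x : R)}.
Proof.
move=> bh; set m := (\int[mu]_(x in setT) h x).
pose g x := h x - m.
have bg : bounded_measurable g.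
  by apply: bounded_measurableB => //; exact: bounded_measurable_cst.
have g0 : \int[mu]_(x in setT) g x = 0.
  rewrite RintegralB//; [|exact: bounded_measurable_integrable|].
    by rewrite Rintegral_cst//; rewrite [X in fine X]probability_setT mulr1 subrr.
  by apply: bounded_measurable_integrable; exact: bounded_measurable_cst.
have [mg [M gM]] := bg.
have := @strong_law_uncorrelated _ _ _ P (fun i w => g (X i w)) M.
move=> /(_ _ _ _)/wrap[]; [|by []| |].
- by move=> i; exact: measurableT_comp.
- by move=> i j ij; rewrite iid_Rintegral_mul// g0 mul0r.
apply: filterS => w gw.
rewrite -[m]add0r.
have : (fun n => n%:R^-1 * (\sum_(i < n) g (X i w)) + m) @ \oo --> 0 + m.
  by apply: cvgD => //; exact: cvg_cst.
(* The centred and raw averages differ by [m] only for [n > 0], hence an eventual equality. *)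
apply: cvg_trans; apply: near_eq_cvg; near=> n.
rewrite sumrB sumr_const card_ord mulrBr -[m *+ n]mulr_natl mulKf ?subrK//.
by rewrite pnatr_eq0 -lt0n; near: n; exists 1%N.
Unshelve. all: by end_near. Qed.

End IidSample.

(** * Deterministic bounds on the prediction error *)

Lemma cvg_sumr (R : realType) I (s : seq I) (u : I -> R^nat) (l : I -> R) :
  (forall i, u i @ \oo --> l i) ->
  (fun n => \sum_(i <- s) u i n) @ \oo --> \sum_(i <- s) l i.
Proof.
by move=> ul; apply: (cvg_big (@add_continuous R^o)) => // i _; exact: ul.
Qed.

(** The difference of the two sides is the empirical variance of [c]. *)
Lemma sqr_mean_le (R : realType) (n : nat) (c : 'I_n -> R) : (0 < n)%N ->
  (n%:R^-1 * \sum_i c i) ^+ 2 <= n%:R^-1 * \sum_i c i ^+ 2.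
Proof.
move=> n0; have n0' : 0 < n%:R :> R by rewrite ltr0n.
set m := n%:R^-1 * \sum_i c i.
have sc : \sum_i c i = n%:R * m by rewrite /m mulVKf ?gt_eqF.
have : 0 <= \sum_i (c i - m) ^+ 2 by apply: sumr_ge0 => i _; exact: sqr_ge0.
rewrite (_ : \sum_i (c i - m) ^+ 2 = \sum_i c i ^+ 2 - n%:R * m ^+ 2).
  by rewrite subr_ge0 ler_pdivlMl.
have -> : \sum_i (c i - m) ^+ 2 = \sum_i (c i ^+ 2 - 2 * m * c i + m ^+ 2).
  by apply: eq_bigr => i _; ring.
by rewrite big_split sumrB /= sumr_const card_ord -mulr_sumr sc -mulr_natl; ring.
Qed.

Section KernelExpansion.
Context (R : realType) (T : Type) (k : T -> T -> R) (psi : nat -> T -> R).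
Hypothesis k_psi : forall x y,
  (fun N => \sum_(0 <= p < N) psi p x * psi p y) @ \oo --> k x y.

Lemma kernel_sym x y : k x y = k y x.
Proof.
rewrite -(cvg_lim (@Rhausdorff R) (@k_psi x y)).
rewrite -(cvg_lim (@Rhausdorff R) (@k_psi y x)).
by under eq_fun do under eq_bigr do rewrite mulrC.
Qed.

Lemma kernel_partial_sum_le x N : \sum_(0 <= p < N) psi p x ^+ 2 <= k x x.
Proof.
have nd : nondecreasing_seq (fun N => \sum_(0 <= p < N) psi p x * psi p x).
  by apply: nondecreasing_series => n _ _; rewrite -expr2 sqr_ge0.
rewrite -(cvg_lim (@Rhausdorff R) (@k_psi x x)).
under eq_bigr do rewrite expr2.
by apply: (nondecreasing_cvgn_le nd); apply/cvg_ex; exists (k x x).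
Qed.

Lemma sqr_psi_le x p : psi p x ^+ 2 <= k x x.
Proof.
apply: le_trans (kernel_partial_sum_le x p.+1).
by rewrite big_nat_recr//= lerDr sumr_ge0// => i _; exact: sqr_ge0.
Qed.

(** By the expansion on the diagonal, this is the sum of [psi p y ^+ 2] over [p >= N]; the
    difference form avoids handling an infinite sum. *)
Definition kernel_tail N y : R := k y y - \sum_(0 <= p < N) psi p y ^+ 2.

Lemma kernel_tail_ge0 N y : 0 <= kernel_tail N y.
Proof. by rewrite subr_ge0 kernel_partial_sum_le. Qed.

Lemma kernel_tail_le N y : kernel_tail N y <= k y y.
Proof. by rewrite gerBl sumr_ge0// => p _; exact: sqr_ge0. Qed.

Lemma kernel_tail_cvg y : (fun N => kernel_tail N y) @ \oo --> (0 : R).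
Proof.
rewrite -[X in _ --> X](subrr (k y y)).
apply: cvgB; first exact: cvg_cst.
by under eq_fun do under eq_bigr do rewrite expr2; exact: k_psi.
Qed.

Variables (tau : R) (n : nat) (pts : 'I_n -> T).
Hypothesis tau0 : 0 < tau.
Implicit Type a : 'cV[R]_n.

Let A := cov_matrix k pts + (n%:R * tau)%:M.

(** The finite sums over the points commute with the limit. The form is thus a limit of sums of
    squares, which gives the positivity of [cov_matrix]. *)
Lemma quadratic_form_cvg a :
  (fun N => \sum_(0 <= p < N) (\sum_i a i 0 * psi p (pts i)) ^+ 2) @ \oo -->
  (a^T *m cov_matrix k pts *m a) 0 0.
Proof.
have -> : (a^T *m cov_matrix k pts *m a) 0 0 =
    \sum_i \sum_j a i 0 * a j 0 * k (pts j) (pts i).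
  rewrite mxE; apply: eq_bigr => i _; rewrite !mxE mulr_suml.
  by apply: eq_bigr => j _; rewrite !mxE; ring.
have -> : (fun N => \sum_(0 <= p < N) (\sum_i a i 0 * psi p (pts i)) ^+ 2) =
    (fun N => \sum_i \sum_j a i 0 * a j 0 *
      \sum_(0 <= p < N) psi p (pts j) * psi p (pts i)).
  apply/funext => N; under eq_bigr do rewrite expr2 mulr_suml.
  rewrite exchange_big; apply: eq_bigr => i _.
  under eq_bigr do rewrite mulr_sumr.
  rewrite exchange_big; apply: eq_bigr => j _.
  by rewrite mulr_sumr; apply: eq_bigr => p _; ring.
do 2 (apply: cvg_sumr => ?).
by apply: cvgMl_tmp; exact: k_psi.
Qed.

Lemma regularized_form a : (a^T *m A *m a) 0 0 =
  (a^T *m cov_matrix k pts *m a) 0 0 + n%:R * tau * \sum_i a i 0 ^+ 2.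
Proof.
rewrite mulmxDr mulmxDl mxE; congr (_ + _).
rewrite mul_mx_scalar -scalemxAl mxE; congr (_ * _).
by rewrite mxE; apply: eq_bigr => i _; rewrite !mxE expr2.
Qed.

Lemma regularized_form_ge a :
  n%:R * tau * \sum_i a i 0 ^+ 2 <= (a^T *m A *m a) 0 0.
Proof.
rewrite regularized_form lerDr.
apply: (cvgr_to_ge (@quadratic_form_cvg a)); apply: nearW => N.
by apply: sumr_ge0 => p _; exact: sqr_ge0.
Qed.

(** The noise makes the form coercive: a vector killed by [A] satisfies [n tau |v| ^ 2 <= 0]. *)
Lemma regularized_unit : (0 < n)%N -> A \in unitmx.
Proof.
move=> n0; rewrite -row_free_unit; apply: inj_row_free => v vA0.
have := regularized_form_ge v^T; rewrite trmxK vA0 mul0mx mxE.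
rewrite pmulr_rle0 ?mulr_gt0 ?ltr0n// => sv.
have : \sum_i v^T i 0 ^+ 2 == 0.
  by rewrite eq_le sv sumr_ge0// => i _; exact: sqr_ge0.
rewrite psumr_eq0 => [/allP v0|i _]; last exact: sqr_ge0.
apply/rowP => i; have := v0 i (mem_index_enum i).
by rewrite sqrf_eq0 !mxE => /eqP.
Qed.

Lemma regularized_sym : A^T = A.
Proof.
apply/matrixP => i j; rewrite !mxE kernel_sym; congr (_ + _).
by rewrite eq_sym.
Qed.

Variable x : T.

Let v := cov_vector k pts x.

(** Completing the square: with [b = A^-1 v], the excess error of [a] is [(a - b)^T A (a - b)],
    which is nonnegative. *)
Lemma blup_mse_le_mse a : (0 < n)%N -> blup_mse k tau pts x <= mse k tau pts x a.
Proof.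
move=> n0; have uA := regularized_unit n0.
pose b := invmx A *m v.
have vE : v = A *m b by rewrite mulKVmx.
have vTE : v^T = b^T *m A by rewrite vE trmx_mul regularized_sym.
rewrite /blup_mse /mse -/A -/v.
have -> : v^T *m invmx A *m v = b^T *m A *m b by rewrite -mulmxA -/b vTE.
have -> : (a^T *m v) 0 0 = (a^T *m A *m b) 0 0 by rewrite vE mulmxA.
have ab : (b^T *m A *m a) 0 0 = (a^T *m A *m b) 0 0.
  have <- : (a^T *m A *m b)^T = b^T *m A *m a.
    by rewrite !trmx_mul trmxK regularized_sym mulmxA.
  by rewrite [LHS]mxE.
have : 0 <= ((a - b)^T *m A *m (a - b)) 0 0.
  apply: le_trans (regularized_form_ge _).
  by rewrite !mulr_ge0 ?ler0n ?sumr_ge0 ?ltW// => i _; exact: sqr_ge0.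
rewrite [(a - b)^T]raddfB /= !mulmxBl !mulmxBr.
have mxB (M N : 'M[R]_1) : (M - N) 0 0 = M 0 0 - N 0 0 by rewrite !mxE.
rewrite !mxB ab; lra.
Qed.

Let u a p := psi p x - \sum_i a i 0 * psi p (pts i).

(** Expanding [u a p ^+ 2] and summing over [p] produces the variance, cross and quadratic terms of
    the error, each of which converges by the kernel expansion. *)
Lemma mse_cvg a : (fun N => \sum_(0 <= p < N) u a p ^+ 2) @ \oo -->
  mse k tau pts x a - n%:R * tau * \sum_i a i 0 ^+ 2.
Proof.
rewrite /mse -/A regularized_form addrA addrK.
have -> : (a^T *m cov_vector k pts x) 0 0 = \sum_i a i 0 * k x (pts i).
  by rewrite mxE; apply: eq_bigr => i _; rewrite !mxE.
rewrite (_ : (fun N => _) = (fun N => \sum_(0 <= p < N) psi p x * psi p x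
  - 2 * (\sum_i a i 0 * \sum_(0 <= p < N) psi p x * psi p (pts i))
  + \sum_(0 <= p < N) (\sum_i a i 0 * psi p (pts i)) ^+ 2)); last first.
  apply/funext => N.
  have -> : \sum_i a i 0 * (\sum_(0 <= p < N) psi p x * psi p (pts i)) =
      \sum_(0 <= p < N) psi p x * \sum_i a i 0 * psi p (pts i).
    under eq_bigr do rewrite mulr_sumr.
    rewrite exchange_big; apply: eq_bigr => p _; rewrite mulr_sumr.
    by apply: eq_bigr => i _; ring.
  rewrite mulr_sumr -sumrB -big_split; apply: eq_bigr => p _.
  by rewrite /u /=; ring.
apply: cvgD; last exact: quadratic_form_cvg.
apply: cvgB; first exact: k_psi.
apply: cvgMl_tmp; apply: cvg_sumr => i; apply: cvgMl_tmp; exact: k_psi.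
Qed.

(* Young's inequality [u ^ 2 >= 2 b u - b ^ 2] on each retained mode and
   [n tau a ^ 2 - 2 a f >= - f ^ 2 / (n tau)] on each weight. *)
Lemma blup_mse_ge N (b : R^nat) : (0 < n)%N ->
  \sum_(0 <= p < N) (2 * b p * psi p x - b p ^+ 2) -
    tau^-1 * (n%:R^-1 * \sum_i (\sum_(0 <= p < N) b p * psi p (pts i)) ^+ 2)
  <= blup_mse k tau pts x.
Proof.
(* The error is attained at the weights [a]; the estimates [h1], [h2] and [h3] use nothing specific
   to this choice. *)
move=> n0; rewrite -(mse_blup x (regularized_unit n0)).
set a := (_ *m _)^T.
pose f i := \sum_(0 <= p < N) b p * psi p (pts i).
have ntau : 0 < n%:R * tau by rewrite mulr_gt0 ?ltr0n.
have h1 : \sum_(0 <= p < N) u a p ^+ 2 <=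
    mse k tau pts x a - n%:R * tau * \sum_i a i 0 ^+ 2.
  apply: (cvgr_to_ge (@mse_cvg a)); exists N => // M /= NM.
  rewrite (big_cat_nat _ NM)//= lerDl sumr_ge0// => p _; exact: sqr_ge0.
have h2 : \sum_(0 <= p < N) (2 * b p * psi p x - b p ^+ 2)
    - 2 * (\sum_i a i 0 * f i) <= \sum_(0 <= p < N) u a p ^+ 2.
  have -> : \sum_i a i 0 * f i =
      \sum_(0 <= p < N) b p * \sum_i a i 0 * psi p (pts i).
    under eq_bigr do rewrite mulr_sumr.
    rewrite exchange_big; apply: eq_bigr => p _; rewrite mulr_sumr.
    by apply: eq_bigr => i _; ring.
  rewrite mulr_sumr -sumrB; apply: ler_sum => p _; rewrite /u.
  set s := \sum_i _; rewrite -subr_ge0.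
  rewrite (_ : _ - _ = (psi p x - s - b p) ^+ 2) ?sqr_ge0//; ring.
have h3 : 2 * (\sum_i a i 0 * f i) - n%:R * tau * \sum_i a i 0 ^+ 2 <=
    tau^-1 * (n%:R^-1 * \sum_i f i ^+ 2).
  rewrite !mulr_sumr -sumrB; apply: ler_sum => i _; rewrite -subr_ge0.
  rewrite (_ : _ - _ = (n%:R * tau * a i 0 - f i) ^+ 2 / (n%:R * tau)).
    by rewrite divr_ge0 ?sqr_ge0// ltW.
  by field; rewrite gt_eqF// gt_eqF// ltr0n.
rewrite -/(f _); lra.
Qed.

(** The optimal error is compared with that of the weights [g (pts i) / n]. Modes below [N] are kept
    exactly. On the others, [(r - s) ^ 2 <= 2 r ^ 2 + 2 s ^ 2] and [sqr_mean_le] apply, and summing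
    over [p] gives the kernel tails. *)
Lemma blup_mse_le N (g : T -> R) : (0 < n)%N ->
  blup_mse k tau pts x <=
  \sum_(0 <= p < N)
     (psi p x - n%:R^-1 * \sum_i g (pts i) * psi p (pts i)) ^+ 2
  + tau * (n%:R^-1 * \sum_i g (pts i) ^+ 2)
  + 2 * kernel_tail N x
  + 2 * (n%:R^-1 * \sum_i g (pts i) ^+ 2 * kernel_tail N (pts i)).
Proof.
move=> n0; pose a : 'cV[R]_n := \col_i (n%:R^-1 * g (pts i)).
apply: le_trans (blup_mse_le_mse a n0) _.
have uE p : u a p = psi p x - n%:R^-1 * \sum_i g (pts i) * psi p (pts i).
  by congr (_ - _); rewrite mulr_sumr; apply: eq_bigr => i _; rewrite mxE mulrA.
have -> : tau * (n%:R^-1 * \sum_i g (pts i) ^+ 2) =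
    n%:R * tau * \sum_i a i 0 ^+ 2.
  rewrite !mulr_sumr; apply: eq_bigr => i _; rewrite mxE.
  by field; rewrite pnatr_eq0 -lt0n.
suff : mse k tau pts x a - n%:R * tau * \sum_i a i 0 ^+ 2 <=
    \sum_(0 <= p < N)
      (psi p x - n%:R^-1 * \sum_i g (pts i) * psi p (pts i)) ^+ 2 +
    (2 * kernel_tail N x +
     2 * (n%:R^-1 * \sum_i g (pts i) ^+ 2 * kernel_tail N (pts i))) by lra.
apply: (cvgr_to_le (@mse_cvg a)); exists N => // M /= NM.
rewrite (big_cat_nat _ NM)//=.
rewrite (eq_bigr (fun p => (psi p x -
  n%:R^-1 * \sum_i g (pts i) * psi p (pts i)) ^+ 2)); last first.
  by move=> p _; rewrite uE.
rewrite lerD2l.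
have tailE y : \sum_(N <= p < M) psi p y ^+ 2 <= kernel_tail N y.
  rewrite lerBrDl (le_trans _ (kernel_partial_sum_le y M))//.
  by rewrite [leRHS](big_cat_nat _ NM).
apply: (@le_trans _ _ (\sum_(N <= p < M) (2 * psi p x ^+ 2 +
   2 * (n%:R^-1 * \sum_i g (pts i) ^+ 2 * psi p (pts i) ^+ 2)))).
  apply: ler_sum => p _; rewrite uE.
  have := sqr_mean_le (fun i => g (pts i) * psi p (pts i)) n0.
  under [X in _ <= _ * X -> _]eq_bigr do rewrite exprMn.
  set s := _ * \sum_i _; set t := _ * \sum_i _ => st.
  have := sqr_ge0 (psi p x + s); nra.
rewrite big_split /= -!mulr_sumr lerD// ler_wpM2l// ler_wpM2l ?invr_ge0//.
rewrite exchange_big; apply: ler_sum => i _.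
by rewrite -mulr_sumr ler_wpM2l ?sqr_ge0.
Qed.

End KernelExpansion.

(** * Almost sure limit *)

(** The index [N] is fixed before [n], so the bounds may converge in [n] at a speed depending on
    [N]. *)
Lemma cvg_sandwich (R : realType) (y l h : R^nat) (lo hi : nat -> R^nat) (L : R) :
  (forall N, \forall n \near \oo, lo N n <= y n <= hi N n) ->
  (forall N, lo N @ \oo --> l N) -> (forall N, hi N @ \oo --> h N) ->
  l @ \oo --> L -> h @ \oo --> L -> y @ \oo --> L.
Proof.
move=> yb lol hih lL hL; apply/cvgrPdist_le => e e0.
have e20 : 0 < e / 2 by rewrite divr_gt0.
have [N [lN hN]] : exists N, `|L - l N| <= e / 2 /\ `|L - h N| <= e / 2.
  have := filterI ((cvgrPdist_le _ _).1 lL _ e20) ((cvgrPdist_le _ _).1 hL _ e20).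
  by case=> N _ /(_ N (leqnn N)); exists N.
near=> n.
have /andP[yl yh] : lo N n <= y n <= hi N n by near: n; exact: yb.
have ln : `|l N - lo N n| <= e / 2.
  by near: n; exact: ((cvgrPdist_le _ _).1 (lol N) _ e20).
have hn : `|h N - hi N n| <= e / 2.
  by near: n; exact: ((cvgrPdist_le _ _).1 (hih N) _ e20).
move: lN hN ln hn; rewrite !ler_norml => /andP[? ?] /andP[? ?] /andP[? ?] /andP[? ?].
apply/andP; split; lra.
Unshelve. all: by end_near. Qed.

Lemma bounded_convergence (R : realType) d (T : measurableType d)
    (mu : probability T R) (f : nat -> T -> R) (M : R) :
  (forall n, measurable_fun setT (f n)) -> (forall n x, `|f n x| <= M) ->
  {ae mu, forall x, (fun n => f n x) @ \oo --> (0 : R)} ->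
  (fun n => \int[mu]_(x in setT) f n x) @ \oo --> (0 : R).
Proof.
move=> mf fM f0.
have [|||||_ _] := @dominated_convergence _ _ _ mu setT measurableT
    (fun n x => (f n x)%:E) (fun=> 0%E) (fun=> M%:E).
- by move=> n; apply/measurable_EFinP.
- exact: measurable_cst.
- apply: filterS f0 => x fx _; exact: (cvg_comp _ _ fx).
- by apply: bounded_measurable_integrable; exact: bounded_measurable_cst.
- by apply: aeW => x n _; rewrite lee_fin.
rewrite integral0 => /fine_cvg/=; exact.
Qed.

Section AlmostSure.
Context (R : realType) (dO dT : measure_display) (Omega : measurableType dO)
  (T : measurableType dT) (P : probability Omega R) (mu : probability T R)
  (X : nat -> {RV P >-> T}) (k : T -> T -> R) (psi : nat -> T -> R)
  (ell : nat -> R) (C tau : R).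
Hypothesis hX : iid_sample mu X.
Hypothesis k_psi : forall x y,
  (fun N => \sum_(0 <= p < N) psi p x * psi p y) @ \oo --> k x y.
Hypothesis k_le : forall x, k x x <= C.
Hypothesis mpsi : forall p, measurable_fun setT (psi p).
Hypothesis psi_orth : forall p q,
  \int[mu]_(x in setT) (psi p x * psi q x) = ell p * (p == q)%:R.
Hypothesis ell_ge0 : forall p, 0 <= ell p.
Hypothesis tau0 : 0 < tau.

Lemma bounded_measurable_psi p : bounded_measurable (psi p).
Proof.
split => //; exists (Num.sqrt C) => x; rewrite -sqrtr_sqr ler_wsqrtr//.
by rewrite (le_trans (sqr_psi_le k_psi x p)).
Qed.

Lemma bounded_measurable_tail N : bounded_measurable (kernel_tail k psi N).
Proof.
split.
  apply: measurable_funB.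
    (* The diagonal [k y y] is measurable as a pointwise limit of measurable partial sums. *)
    apply: (@measurable_fun_cvg _ _ _ _
      (fun N y => \sum_(0 <= p < N) psi p y * psi p y)) => [M|y _].
      by apply: measurable_sum => p; exact: measurable_funM.
    exact: k_psi.
  by apply: measurable_sum => p; exact: measurable_funX.
exists C => y; rewrite ger0_norm ?kernel_tail_ge0//.
by rewrite (le_trans (kernel_tail_le _ _ _ _)).
Qed.

Variable x : T.

(** These coefficients maximize [2 b psi - b ^ 2 - b ^ 2 ell / tau], the contribution of one mode to
    the large-sample limit of the lower bound. *)
Let b p := tau / (tau + ell p) * psi p x.
Let f N y := \sum_(0 <= p < N) b p * psi p y.
Let L N := \sum_(0 <= p < N) tau / (tau + ell p) * psi p x ^+ 2.
Let g N y := tau^-1 * f N y.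
Let err N := 2 * kernel_tail k psi N x +
  2 * \int[mu]_(y in setT) (g N y ^+ 2 * kernel_tail k psi N y).

Let tau_ell p : 0 < tau + ell p. Proof. by rewrite ltr_wpDr. Qed.

Let shrink p : 0 <= tau / (tau + ell p) <= 1.
Proof.
by rewrite divr_ge0 ?(ltW tau0) ?(ltW (tau_ell p))//= ler_pdivrMr// mul1r lerDl.
Qed.

Let bf N : bounded_measurable (f N).
Proof.
apply: bounded_measurable_sum => p; apply: bounded_measurableM.
  exact: bounded_measurable_cst.
exact: bounded_measurable_psi.
Qed.

Let bg N : bounded_measurable (g N).
Proof. by apply: bounded_measurableM => //; exact: bounded_measurable_cst. Qed.

(** Since the shrinkage factors are at most [1], each term is at most
    [(psi_p x ^ 2 + psi_p y ^ 2) / 2], and these sum to at most [(k x x + k y y) / 2]. Uniformity in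
    [N] is what allows dominated convergence in [err_cvg]. *)
Let f_le N y : `|f N y| <= C.
Proof.
rewrite /f (le_trans (ler_norm_sum _ _ _))//.
apply: (@le_trans _ _ (\sum_(0 <= p < N) 2^-1 * (psi p x ^+ 2 + psi p y ^+ 2))).
  apply: ler_sum => p _; rewrite -[psi p x ^+ 2]real_normK ?num_real//.
  rewrite -[psi p y ^+ 2]real_normK ?num_real//.
  have /andP[s0 s1] := shrink p.
  rewrite /b -mulrA normrM (ger0_norm s0) normrM.
  set s := _ / _ in s0 s1 *.
  have := normr_ge0 (psi p x); have := normr_ge0 (psi p y).
  set u := `|psi p x|; set v := `|psi p y| => v0 u0.
  apply: (@le_trans _ _ (u * v)); first by rewrite ler_piMl// mulr_ge0.
  have := sqr_ge0 (u - v); lra.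
rewrite -mulr_sumr big_split /=.
have := kernel_partial_sum_le k_psi x N; have := kernel_partial_sum_le k_psi y N.
have := k_le x; have := k_le y; lra.
Qed.

Let int_f_psi N p : (p < N)%N ->
  \int[mu]_(y in setT) (f N y * psi p y) = b p * ell p.
Proof.
move=> pN; under eq_Rintegral do rewrite /f mulr_suml.
rewrite Rintegral_sum; last first.
  move=> q; do 2 (apply: bounded_measurableM; last exact: bounded_measurable_psi).
  exact: bounded_measurable_cst.
rewrite (bigD1_seq p) ?mem_index_iota ?iota_uniq//= [X in _ + X]big1 ?addr0; last first.
  move=> q qp; under eq_Rintegral do rewrite -mulrA.
  rewrite RintegralZl// ?psi_orth ?(negPf qp) ?mulr0//.
  by apply: bounded_measurable_integrable; apply: bounded_measurableM;
    exact: bounded_measurable_psi.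
under eq_Rintegral do rewrite -mulrA.
rewrite RintegralZl// ?psi_orth ?eqxx ?mulr1//.
by apply: bounded_measurable_integrable; apply: bounded_measurableM;
  exact: bounded_measurable_psi.
Qed.

Let int_f_sqr N : \int[mu]_(y in setT) (f N y ^+ 2) =
  \sum_(0 <= p < N) b p ^+ 2 * ell p.
Proof.
under eq_Rintegral do rewrite expr2 {2}/f mulr_sumr.
rewrite Rintegral_sum; last first.
  move=> q; apply: bounded_measurableM => //; apply: bounded_measurableM.
    exact: bounded_measurable_cst.
  exact: bounded_measurable_psi.
apply: eq_big_nat => p /andP[_ pN].
under eq_Rintegral do rewrite mulrCA.
rewrite RintegralZl// ?int_f_psi//; first by rewrite mulrA -expr2.
by apply: bounded_measurable_integrable; apply: bounded_measurableM => //;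
  exact: bounded_measurable_psi.
Qed.

Let L_cvg : L @ \oo --> limn L.
Proof.
apply: nondecreasing_is_cvgn.
  apply: nondecreasing_series => n _ _; rewrite mulr_ge0 ?sqr_ge0//.
  by case/andP: (shrink n).
exists (k x x) => _ [N _ <-].
apply: le_trans (kernel_partial_sum_le k_psi x N).
apply: ler_sum => p _; rewrite ler_piMl ?sqr_ge0//.
by case/andP: (shrink p).
Qed.

Let err_cvg : err @ \oo --> (0 : R).
Proof.
rewrite -[X in _ --> X]addr0 -[X in _ --> X + _](mulr0 2) -[X in _ --> _ + X](mulr0 2).
apply: cvgD; apply: cvgMl_tmp; first exact: kernel_tail_cvg.
have bh N : bounded_measurable (fun y => g N y ^+ 2 * kernel_tail k psi N y).
  apply: bounded_measurableM; last exact: bounded_measurable_tail.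
  exact: bounded_measurableX.
have g_le N y : g N y ^+ 2 <= (tau^-1 * C) ^+ 2.
  rewrite -real_normK ?num_real// lerXn2r ?nnegrE//.
    by rewrite mulr_ge0 ?invr_ge0 ?(ltW tau0)// (le_trans _ (f_le N y)).
  by rewrite normrM ger0_norm ?invr_ge0 ?(ltW tau0)// ler_wpM2l ?invr_ge0 ?(ltW tau0).
have C0 : 0 <= C by rewrite (le_trans _ (f_le 0 x)).
apply: (@bounded_convergence _ _ _ _ _ ((tau^-1 * C) ^+ 2 * C)).
- by move=> N; case: (bh N).
- move=> N y; rewrite normrM ler_pM// ger0_norm ?sqr_ge0 ?kernel_tail_ge0//.
  by rewrite (le_trans (kernel_tail_le _ _ _ _)).
- apply: aeW => y; rewrite -[X in _ --> X](mulr0 ((tau^-1 * C) ^+ 2)).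
  apply: (@squeeze_cvgr _ _ _ _ (fun=> 0)
    (fun N => (tau^-1 * C) ^+ 2 * kernel_tail k psi N y)).
  + apply: nearW => N; rewrite mulr_ge0 ?sqr_ge0 ?kernel_tail_ge0//=.
    by rewrite ler_wpM2r ?kernel_tail_ge0.
  + by rewrite mulr0; exact: cvg_cst.
  + by apply: cvgMl_tmp; exact: kernel_tail_cvg.
Qed.

Lemma blup_mse_cvg_almost_surely :
  cvg_almost_surely P (fun n w => blup_mse k tau (fun i : 'I_n => X i w) x)
    (limn L).
Proof.
have lln h : bounded_measurable h ->
    {ae P, forall w, (fun n => n%:R^-1 * \sum_(i < n) h (X i w)) @ \oo -->
      (\int[mu]_(y in setT) h y : R)} by exact: strong_law.
(* The limit in [N] is taken along a fixed sample, so all the laws must hold on one event of full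
   measure; countably many [N] and [p] permit this. *)
have ae1 : {ae P, forall w, forall N,
    (fun n => n%:R^-1 * \sum_(i < n) f N (X i w) ^+ 2) @ \oo -->
      (\int[mu]_(y in setT) (f N y ^+ 2) : R)}.
  by apply: ae_foralln => N; apply: (lln (fun y => _)); exact: bounded_measurableX.
have ae2 : {ae P, forall w, forall N p,
    (fun n => n%:R^-1 * \sum_(i < n) g N (X i w) * psi p (X i w)) @ \oo -->
      (\int[mu]_(y in setT) (g N y * psi p y) : R)}.
  apply: ae_foralln => N; apply: ae_foralln => p; apply: (lln (fun y => _)).
  by apply: bounded_measurableM => //; exact: bounded_measurable_psi.
have ae3 : {ae P, forall w, forall N,
    (fun n => n%:R^-1 * \sum_(i < n) g N (X i w) ^+ 2) @ \oo -->
      (\int[mu]_(y in setT) (g N y ^+ 2) : R)}.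
  by apply: ae_foralln => N; apply: (lln (fun y => _)); exact: bounded_measurableX.
have ae4 : {ae P, forall w, forall N,
    (fun n => n%:R^-1 * \sum_(i < n) g N (X i w) ^+ 2 * kernel_tail k psi N (X i w))
      @ \oo --> (\int[mu]_(y in setT) (g N y ^+ 2 * kernel_tail k psi N y) : R)}.
  apply: ae_foralln => N; apply: (lln (fun y => _)).
  apply: bounded_measurableM; last exact: bounded_measurable_tail.
  exact: bounded_measurableX.
rewrite /cvg_almost_surely.
apply: filterS2 (filterI ae1 ae2) (filterI ae3 ae4) => w [h1 h2] [h3 h4].
apply: (@cvg_sandwich _ _ L (fun N => L N + err N)
  (fun N n => \sum_(0 <= p < N) (2 * b p * psi p x - b p ^+ 2) -
    tau^-1 * (n%:R^-1 * \sum_(i < n) f N (X i w) ^+ 2))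
  (fun N n => \sum_(0 <= p < N)
     (psi p x - n%:R^-1 * \sum_(i < n) g N (X i w) * psi p (X i w)) ^+ 2
  + tau * (n%:R^-1 * \sum_(i < n) g N (X i w) ^+ 2)
  + 2 * kernel_tail k psi N x
  + 2 * (n%:R^-1 * \sum_(i < n) g N (X i w) ^+ 2 * kernel_tail k psi N (X i w)))).
- move=> N; exists 1%N => // n /= n0.
  by rewrite (blup_mse_ge k_psi)// (blup_mse_le k_psi).
- move=> N; have -> : L N = \sum_(0 <= p < N) (2 * b p * psi p x - b p ^+ 2) -
      tau^-1 * \int[mu]_(y in setT) (f N y ^+ 2).
    rewrite int_f_sqr mulr_sumr -sumrB; apply: eq_bigr => p _; rewrite /b.
    by field; rewrite !gt_eqF.
  by apply: cvgB; [exact: cvg_cst | apply: cvgMl_tmp; exact: h1].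
- move=> N; rewrite /err addrA.
  (* In the limit the residual [psi - b ell / tau] equals [b] again, so a mode contributes
     [b ^ 2 (1 + ell / tau)], which is its term in [L N]. *)
  have -> : L N = \sum_(0 <= p < N)
      (psi p x - \int[mu]_(y in setT) (g N y * psi p y)) ^+ 2 +
      tau * \int[mu]_(y in setT) (g N y ^+ 2).
    under [X in _ = _ + _ * X]eq_Rintegral do rewrite exprMn.
    rewrite RintegralZl//; last first.
      by apply: bounded_measurable_integrable; exact: bounded_measurableX.
    rewrite int_f_sqr !mulr_sumr -big_split; apply: eq_big_nat => p /andP[_ pN].
    under eq_Rintegral do rewrite -mulrA.
    rewrite RintegralZl//; last first.
      apply: bounded_measurable_integrable; apply: bounded_measurableM => //.
      exact: bounded_measurable_psi.
    rewrite int_f_psi// /b /=.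
    by field; rewrite !gt_eqF.
  apply: cvgD; last by apply: cvgMl_tmp; exact: h4.
  apply: cvgD; last exact: cvg_cst.
  apply: cvgD; last by apply: cvgMl_tmp; exact: h3.
  apply: cvg_sumr => p.
  under eq_fun do rewrite expr2.
  by rewrite expr2; apply: cvgM; (apply: cvgB; [exact: cvg_cst | exact: h2]).
- exact: L_cvg.
- by rewrite -[X in _ --> X]addr0; exact: cvgD.
Qed.

End AlmostSure.

(** * Convergence in probability *)

(** Writing the inverse as [h (h ^ 2)^-1] reduces it to a real power of a nonnegative function; at a
    zero of [h] both sides are [0]. *)
Lemma measurable_fun_invr (R : realType) d (T : measurableType d) (h : T -> R) :
  measurable_fun setT h -> measurable_fun setT (fun x => (h x)^-1).
Proof.
move=> mh; have -> : (fun x => (h x)^-1) = (fun x => h x * (h x ^+ 2) `^ (-1)).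
  apply/funext => x; rewrite powR_inv1 ?sqr_ge0//.
  have [->|hx0] := eqVneq (h x) 0; first by rewrite invr0 mul0r.
  by field.
apply: measurable_funM => //.
exact: (measurableT_comp (@measurable_powR R (-1)) (measurable_funX 2 mh)).
Qed.

(** * Measurability of the prediction error in the sample *)

Section MeasurableMatrix.
Context (R : realType) (d : measure_display) (T : measurableType d).

Lemma measurable_det n (A : T -> 'M[R]_n) :
  (forall i j, measurable_fun setT (fun w => A w i j)) ->
  measurable_fun setT (fun w => \det (A w)).
Proof.
move=> mA; apply: measurable_sum => s.
apply: measurable_funM; first exact: measurable_cst.
by apply: measurable_prod => i _; exact: mA.
Qed.

(** Cramer's formula expresses the entries of the inverse through determinants; [uA] selects the
    branch of [invmx] where it applies. *)
Lemma measurable_invmx n (A : T -> 'M[R]_n) :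
  (forall w, A w \in unitmx) ->
  (forall i j, measurable_fun setT (fun w => A w i j)) ->
  forall i j, measurable_fun setT (fun w => invmx (A w) i j).
Proof.
move=> uA mA i j; under eq_fun do rewrite /invmx uA !mxE.
apply: measurable_funM; first by apply: measurable_fun_invr; exact: measurable_det.
apply: measurable_funM; first exact: measurable_cst.
apply: measurable_det => p q; under eq_fun do rewrite !mxE.
exact: mA.
Qed.

End MeasurableMatrix.

(** The probability of a deviation is the integral of an indicator that is eventually zero at almost
    every point, so bounded convergence applies. *)
Lemma cvg_almost_surely_in_probability (R : realType) d (T : measurableType d)
    (P : probability T R) (Y : nat -> T -> R) (l : R) :
  (forall n, measurable_fun setT (Y n)) ->
  cvg_almost_surely P Y l -> cvg_in_probability P Y l.
Proof.
move=> mY Yl e e0; pose S n := [set w | e <= `|Y n w - l|].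
have mS n : measurable (S n).
  have -> : S n = setT `&` (fun w => `|Y n w - l|) @^-1` `[e, +oo[%classic.
    by apply/seteqP; split => w; rewrite /S setTI /= in_itv/= andbT.
  have mf : measurable_fun setT (fun w => `|Y n w - l|).
    apply: measurableT_comp => //.
    by apply: measurable_funB => //; exact: measurable_cst.
  by apply: mf => //; exact: measurable_itv.
have PE n : P (S n) = (\int[P]_(w in setT) \1_(S n) w)%:E.
  by rewrite /Rintegral integral_indic// setIT fineK// fin_num_measure.
rewrite (_ : (fun n => _) = (fun n => (\int[P]_(w in setT) \1_(S n) w)%:E)); last first.
  by apply/funext.
apply: cvg_EFin; first exact: nearW.
apply: (@bounded_convergence _ _ _ _ _ 1).
- by move=> n; exact: measurable_indic.
- by move=> n w; rewrite indicE; case: (_ \in _); rewrite ?normr1 ?normr0.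
- apply: filterS Yl => w Yw.
  apply: cvg_near_cst; near=> n.
  rewrite indicE memNset// /S /=; apply/negP; rewrite -ltNge distrC.
  by near: n; exact: (cvgrPdist_lt _ _).1 Yw _ e0.
Unshelve. all: by end_near. Qed.

Section MeasurableBlup.
Context (R : realType) (dO dT : measure_display) (Omega : measurableType dO)
  (T : measurableType dT) (k : T -> T -> R) (psi : nat -> T -> R) (tau : R).
Hypothesis k_psi : forall x y,
  (fun N => \sum_(0 <= p < N) psi p x * psi p y) @ \oo --> k x y.
Hypothesis mpsi : forall p, measurable_fun setT (psi p).
Hypothesis tau0 : 0 < tau.

Lemma measurable_kernel (Y Z : Omega -> T) :
  measurable_fun setT Y -> measurable_fun setT Z ->
  measurable_fun setT (fun w => k (Y w) (Z w)).
Proof.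
move=> mY mZ; apply: (@measurable_fun_cvg _ _ _ _
  (fun N w => \sum_(0 <= p < N) psi p (Y w) * psi p (Z w))) => [N|w _].
  by apply: measurable_sum => p; apply: measurable_funM; exact: measurableT_comp.
exact: k_psi.
Qed.

Lemma measurable_blup_mse n (Y : 'I_n -> Omega -> T) x :
  (forall i, measurable_fun setT (Y i)) ->
  measurable_fun setT (fun w => blup_mse k tau (Y^~ w) x).
Proof.
move=> mY; rewrite /blup_mse.
apply: measurable_funB; first exact: measurable_cst.
have mv i : measurable_fun setT (fun w => k x (Y i w)).
  by apply: measurable_kernel => //; exact: measurable_cst.
under eq_fun do rewrite mxE.
apply: measurable_sum => j; under eq_fun do rewrite !mxE.
apply: measurable_funM => //; apply: measurable_sum => i.
under eq_fun do rewrite !mxE.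
apply: measurable_funM => //; apply: measurable_invmx => [w|p q].
  (* The index [i] rules out [n = 0], where [regularized_unit] does not apply. *)
  by apply: (regularized_unit k_psi) => //; case: n i {j Y mY mv} => [[]|].
under eq_fun do rewrite !mxE.
apply: measurable_funD; first exact: measurable_kernel.
exact: measurable_cst.
Qed.

End MeasurableBlup.

(** * Mercer features *)

Section MercerFeatures.
Context (R : realType) (dT : measure_display) (T : measurableType dT)
  (mu : probability T R) (k : T -> T -> R) (D : set nat) (lam : nat -> R)
  (phi : nat -> T -> R).
Hypothesis hMercer : mercer_representation mu k D lam phi.

(** Extension by zero suppresses the arbitrary values of [lam] and [phi] outside [D], so that finite
    and infinite bases are both handled as sequences over all of [nat]. *)
Definition basis_eigenvalue (p : nat) : R := if p \in D then lam p else 0.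

Definition feature (p : nat) (x : T) : R :=
  Num.sqrt (basis_eigenvalue p) * phi p x.

Lemma basis_eigenvalue_ge0 p : 0 <= basis_eigenvalue p.
Proof.
rewrite /basis_eigenvalue; case: ifPn => // /set_mem pD.
by case: hMercer => _ _ lam0 _ _; exact: lam0.
Qed.

Lemma featureM p x y :
  feature p x * feature p y = basis_eigenvalue p * phi p x * phi p y.
Proof.
rewrite /feature mulrACA -expr2 sqr_sqrtr ?basis_eigenvalue_ge0//.
by rewrite mulrA.
Qed.

Lemma feature_expansion x y :
  (fun N => \sum_(0 <= p < N) feature p x * feature p y) @ \oo --> k x y.
Proof.
case: hMercer => _ _ _ _ /(_ x y).
rewrite [X in X @ _ --> _ -> _](_ : _ =
  (fun N => \sum_(0 <= p < N) feature p x * feature p y))//.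
apply/funext => N; rewrite big_mkcond; apply: eq_bigr => p _.
by rewrite featureM /basis_eigenvalue; case: ifP => // _; rewrite !mul0r.
Qed.

Lemma measurable_feature p : measurable_fun setT (feature p).
Proof.
have [pD|pD] := boolP (p \in D); last first.
  rewrite (_ : feature p = cst 0)//; apply/funext => x.
  by rewrite /feature /basis_eigenvalue (negPf pD) sqrtr0 mul0r.
case: hMercer => -[_ [/(_ _ (set_mem pD)) + _ _]] _ _ _ _.
move=> /(sub_Lfun_mfun); rewrite inE => mphi.
by apply: measurable_funM => //; exact: measurable_cst.
Qed.

Lemma feature_orthogonal p q :
  \int[mu]_(x in setT) (feature p x * feature q x) =
  basis_eigenvalue p * (p == q)%:R.
Proof.
under eq_Rintegral do rewrite /feature mulrACA.
(* Outside [D] nothing is known about [phi], not even integrability, so the zero coefficient must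
   cancel the integrand pointwise. *)
have int0 (c : R) : c = 0 ->
    \int[mu]_(x in setT) (c * (phi p x * phi q x)) = 0.
  move=> ->; under eq_Rintegral do rewrite mul0r.
  by rewrite Rintegral_cst// mul0r.
have [pD|pD] := boolP (p \in D); last first.
  rewrite int0; first by rewrite /basis_eigenvalue (negPf pD) mul0r.
  by rewrite /basis_eigenvalue (negPf pD) sqrtr0 mul0r.
have [qD|qD] := boolP (q \in D); last first.
  rewrite int0; last by rewrite /basis_eigenvalue (negPf qD) sqrtr0 mulr0.
  by have [pq|] := eqVneq p q; [move: qD; rewrite -pq pD | rewrite mulr0].
case: hMercer => -[_ [L2 on _]] _ _ _ _.
move/set_mem: pD => pD; move/set_mem: qD => qD.
rewrite RintegralZl//; last first.
  exact: (Lfun1_integrable _ _).1 (Lfun2_mul_Lfun1 (L2 _ pD) (L2 _ qD)).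
have := on _ _ pD qD; rewrite /inner_L2 => ->.
have [<-|] := eqVneq p q; last by rewrite !mulr0.
by rewrite -expr2 sqr_sqrtr ?basis_eigenvalue_ge0.
Qed.

Lemma limit_mse_feature (tau : R) x :
  limit_mse tau D lam phi x = limn (fun N => \sum_(0 <= p < N)
    tau / (tau + basis_eigenvalue p) * feature p x ^+ 2).
Proof.
rewrite /limit_mse [X in limn X](_ : _ = (fun N => \sum_(0 <= p < N)
  tau / (tau + basis_eigenvalue p) * feature p x ^+ 2))//.
apply/funext => N; rewrite big_mkcond; apply: eq_bigr => p _.
rewrite [feature p x ^+ 2]expr2 featureM /basis_eigenvalue; case: ifP => _; last by rewrite !mul0r mulr0.
by rewrite expr2; ring.
Qed.

End MercerFeatures.

Theorem theorem1 (R : realType) (d : nat) (hd : (0 < d)%N)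
  (mu : probability 'rV[R]_d R)
  (k : 'rV[R]_d -> 'rV[R]_d -> R)
  (dZ : measure_display) (OmegaZ : measurableType dZ)
  (PZ : probability OmegaZ R) (Z : 'rV[R]_d -> {RV PZ >-> R})
  (hZ : centered_gaussian_process Z k)
  (hk_cont : continuous (fun xy : 'rV[R]_d * 'rV[R]_d => k xy.1 xy.2))
  (hk_bdd : has_ubound (range (fun x => k x x)))
  (dO : measure_display) (Omega : measurableType dO)
  (P : probability Omega R) (X : nat -> {RV P >-> 'rV[R]_d})
  (hX : iid_sample mu X)
  (tau : R) (htau : 0 < tau)
  (D : set nat) (lam : nat -> R) (phi : nat -> 'rV[R]_d -> R)
  (hMercer : mercer_representation mu k D lam phi) :
  (nondegenerate_spectrum D lam -> forall x : 'rV[R]_d,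
     cvg_in_probability P
       (fun n w => blup_mse k tau (fun i : 'I_n => X i w) x)
       (limit_mse tau D lam phi x)) /\
  (degenerate_spectrum D lam -> forall x : 'rV[R]_d,
     cvg_almost_surely P
       (fun n w => blup_mse k tau (fun i : 'I_n => X i w) x)
       (limit_mse tau D lam phi x)).
Proof.
have [C hC] := hk_bdd.
have k_le x : k x x <= C by apply: hC; exists x.
have as_cvg x : cvg_almost_surely P
    (fun n w => blup_mse k tau (fun i : 'I_n => X i w) x)
    (limit_mse tau D lam phi x).
  rewrite (limit_mse_feature hMercer).
  exact: (blup_mse_cvg_almost_surely hX (feature_expansion hMercer) k_le
    (measurable_feature hMercer) (feature_orthogonal hMercer)
    (basis_eigenvalue_ge0 hMercer) htau).
split=> _ x; last exact: as_cvg.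
(* Passing to convergence in probability leaves the measurability of the error for each sample
   size. *)
apply: cvg_almost_surely_in_probability (as_cvg x) => n.
exact: (measurable_blup_mse (feature_expansion hMercer)
  (measurable_feature hMercer) htau (Y := fun i : 'I_n => X i)).
Qed.
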